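(* Let $\mathcal A$ be an abelian category and let $(\mathcal Q,\widetilde{\mathcal R})$ and $(\widetilde{\mathcal Q},\mathcal R)$ be complete hereditary cotorsion pairs in $\mathcal A$ such that (a) $\widetilde{\mathcal Q}\subseteq\mathcal Q$ (or equivalently, $\widetilde{\mathcal R}\subseteq\mathcal R$); (b) $\mathcal Q\cap\widetilde{\mathcal R}=\widetilde{\mathcal Q}\cap\mathcal R$. Then the following assertions hold: 1. If $\sup\{\mathcal Q\text{-}\mathrm{resdim}_{\mathcal A}(A)\mid A\in\mathcal A\}<\infty$, then $(\mathcal Q,\mathcal W,\mathcal R)$ is a Hovey triple, where $\mathcal W=\{A\in\mathcal A\mid \widetilde{\mathcal Q}\text{-}\mathrm{resdim}_{\mathcal A}(A)<\infty\}$. 2. If $\sup\{\mathcal R\text{-}\mathrm{coresdim}_{\mathcal A}(A)\mid A\in\mathcal A\}<\infty$, then $(\mathcal Q,\mathcal W,\mathcal R)$ is a Hovey triple, where $\mathcal W=\{A\in\mathcal A\mid \widetilde{\mathcal R}\text{-}\mathrm{coresdim}_{\mathcal A}(A)<\infty\}$.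
   Context: For a class $\mathcal X$ of objects of $\mathcal A$, $\mathcal X^\perp=\{M \mid \mathrm{Ext}^1_{\mathcal A}(X,M)=0\ \forall X\in\mathcal X\}$ and ${}^\perp\mathcal X=\{M \mid \mathrm{Ext}^1_{\mathcal A}(M,X)=0\ \forall X\in\mathcal X\}$. A cotorsion pair is a pair $(\mathcal X,\mathcal Y)$ of classes with $\mathcal X^\perp=\mathcal Y$ and $\mathcal X={}^\perp\mathcal Y$; it is hereditary if $\mathrm{Ext}^i_{\mathcal A}(X,Y)=0$ for all $X\in\mathcal X$, $Y\in\mathcal Y$ and $i\ge1$; it is complete if for every $A\in\mathcal A$ there are short exact sequences $0\to Y\to X\to A\to0$ and $0\to A\to Y'\to X'\to0$ with $X,X'\in\mathcal X$ and $Y,Y'\in\mathcal Y$. $\mathcal X\text{-}\mathrm{resdim}_{\mathcal A}(A)$ is the least $n\ge0$ for which there is an exact sequence $0\to X_n\to\cdots\to X_0\to A\to0$ with all $X_i\in\mathcal X$ ($\infty$ if none exists); dually, $\mathcal X\text{-}\mathrm{coresdim}_{\mathcal A}(A)$ is the least $n\ge0$ for which there is an exact sequence $0\to A\to X_0\to\cdots\to X_n\to0$ with all $X_i\in\mathcal X$ ($\infty$ if none exists). A Hovey triple is a triple $(\mathcal Q,\mathcal W,\mathcal R)$ of classes of objects such that $\mathcal W$ is thick (closed under direct summands, extensions, kernels of epimorphisms and cokernels of monomorphisms) and $(\mathcal Q,\mathcal W\cap\mathcal R)$ and $(\mathcal Q\cap\mathcal W,\mathcal R)$ are complete cotorsion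 pairs. *)

(* Defs.v *)
From mathcomp Require Import all_boot all_algebra.
From mathcomp Require Import boolp classical_sets.
From Stdlib Require Import Relation_Operators.

Set Implicit Arguments.
Unset Strict Implicit.
Unset Printing Implicit Defensive.

Import GRing.Theory.
Local Open Scope classical_set_scope.
Local Open Scope ring_scope.

Declare Scope cat_scope.
Delimit Scope cat_scope with cat.

Record preadditive := Preadditive {
  ob :> Type;
  hom : ob -> ob -> zmodType;
  idmor : forall A, hom A A;
  compose : forall A B C, hom B C -> hom A B -> hom A C;
  compose1m : forall A B (f : hom A B), compose (idmor B) f = f;
  composem1 : forall A B (f : hom A B), compose f (idmor A) = f;
  composeA : forall A B C D (h : hom C D) (g : hom B C) (f : hom A B),
    compose h (compose g f) = compose (compose h g) f;
  composeDl : forall A B C (g g' : hom B C) (f : hom A B),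
    compose (g + g') f = compose g f + compose g' f;
  composeDr : forall A B C (g : hom B C) (f f' : hom A B),
    compose g (f + f') = compose g f + compose g f'
}.

Arguments hom {p} A B.
Arguments idmor {p} A.
Arguments compose {p A B C} g f.

Notation "g ∘ f" := (compose g f) (at level 40, left associativity) : cat_scope.
Local Open Scope cat_scope.

Section Morphisms.
Variable C : preadditive.
Implicit Types A B K T : C.

Definition mono A B (f : hom A B) : Prop :=
  forall T (u v : hom T A), f ∘ u = f ∘ v -> u = v.

Definition epi A B (f : hom A B) : Prop :=
  forall T (u v : hom B T), u ∘ f = v ∘ f -> u = v.

Definition iso A B (f : hom A B) : Prop :=
  exists g : hom B A, g ∘ f = idmor A /\ f ∘ g = idmor B.

Definition is_zero A : Prop :=
  forall T, (forall f : hom A T, f = 0) /\ (forall f : hom T A, f = 0).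

Definition is_kernel A B K (f : hom A B) (k : hom K A) : Prop :=
  f ∘ k = 0 /\
  forall T (t : hom T A), f ∘ t = 0 -> exists! u : hom T K, k ∘ u = t.

Definition is_cokernel A B K (f : hom A B) (c : hom B K) : Prop :=
  c ∘ f = 0 /\
  forall T (t : hom B T), t ∘ f = 0 -> exists! u : hom K T, u ∘ c = t.

Definition is_biproduct A1 A2 B (i1 : hom A1 B) (i2 : hom A2 B)
    (p1 : hom B A1) (p2 : hom B A2) : Prop :=
  [/\ p1 ∘ i1 = idmor A1, p2 ∘ i2 = idmor A2, p1 ∘ i2 = 0, p2 ∘ i1 = 0
    & i1 ∘ p1 + i2 ∘ p2 = idmor B].

Definition is_image A B K (f : hom A B) (k : hom K B) : Prop :=
  exists (D : C) (c : hom B D), is_cokernel f c /\ is_kernel c k.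

Definition exact A B D (f : hom A B) (g : hom B D) : Prop :=
  exists (K : C) (k : hom K B), is_image f k /\ is_kernel g k.

Definition short_exact A B D (f : hom A B) (g : hom B D) : Prop :=
  [/\ mono f, exact f g & epi g].

Record is_abelian : Prop := IsAbelian {
  abelian_zero : exists Z : C, is_zero Z;
  abelian_biproduct : forall A1 A2, exists B (i1 : hom A1 B) (i2 : hom A2 B)
    (p1 : hom B A1) (p2 : hom B A2), is_biproduct i1 i2 p1 p2;
  abelian_kernel : forall A B (f : hom A B),
    exists K (k : hom K A), is_kernel f k;
  abelian_cokernel : forall A B (f : hom A B),
    exists K (c : hom B K), is_cokernel f c;
  abelian_mono : forall A B (f : hom A B), mono f ->
    exists D (g : hom B D), is_kernel g f;
  abelian_epi : forall A B (f : hom A B), epi f ->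
    exists D (g : hom D A), is_cokernel g f
}.

End Morphisms.

Record abelian_category := AbelianCategory {
  abelian_cat :> preadditive;
  abelianP : is_abelian abelian_cat
}.

Section Cotorsion.
Variable C : abelian_category.
Implicit Types (A B M : C) (n : nat) (X Y Q W R : set C).

(* An exact sequence 0 -> P_n -> ... -> P_0 -> A -> 0, stored as an
   N-indexed one that vanishes in degrees above n; likewise below for
   0 -> A -> I_0 -> ... -> I_n -> 0. *)
Record resolution n A := Resolution {
  res_ob : nat -> C;
  res_d : forall i, hom (res_ob i.+1) (res_ob i);
  res_aug : hom (res_ob 0) A;
  res_epi : epi res_aug;
  res_exact0 : exact (res_d 0) res_aug;
  res_exact : forall i, exact (res_d i.+1) (res_d i);
  res_zero : forall i, (n < i)%N -> is_zero (res_ob i)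
}.

Record coresolution n A := Coresolution {
  cores_ob : nat -> C;
  cores_d : forall i, hom (cores_ob i) (cores_ob i.+1);
  cores_aug : hom A (cores_ob 0);
  cores_mono : mono cores_aug;
  cores_exact0 : exact cores_aug (cores_d 0);
  cores_exact : forall i, exact (cores_d i) (cores_d i.+1);
  cores_zero : forall i, (n < i)%N -> is_zero (cores_ob i)
}.

(* For n >= 1, an n-fold extension 0 -> B -> E_(n-1) -> ... -> E_0 -> A -> 0,
   i.e. a resolution of A of length n with n-th term identified with B. *)
Record extension n A B := Extension {
  ext_res :> resolution n A;
  ext_iota : hom B (res_ob ext_res n);
  ext_iso : iso ext_iota
}.

(* A morphism of n-fold extensions that is the identity on A and on B. *)
Definition extension_map n A B (E F : extension n A B) : Prop :=
  exists f : forall i, hom (res_ob E i) (res_ob F i),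
    [/\ forall i, f i ∘ res_d E i = res_d F i ∘ f i.+1,
        res_aug F ∘ f 0%N = res_aug E
      & f n ∘ ext_iota E = ext_iota F].

Definition yoneda_equiv n A B : extension n A B -> extension n A B -> Prop :=
  clos_refl_sym_trans _ (@extension_map n A B).

(* Ext^n(A, B) = 0 for n >= 1, with Ext^n the group of Yoneda classes of
   n-fold extensions (no enough projectives or injectives assumed); this group
   is zero iff it has a single element. *)
Definition Ext_zero n A B : Prop :=
  forall E F : extension n A B, yoneda_equiv E F.

Definition right_perp X : set C := [set M | forall A, X A -> Ext_zero 1 A M].

Definition left_perp X : set C := [set M | forall A, X A -> Ext_zero 1 M A].

Definition cotorsion_pair X Y : Prop := right_perp X = Y /\ X = left_perp Y.

Definition hereditary X Y : Prop :=
  forall A B n, X A -> Y B -> (1 <= n)%N -> Ext_zero n A B.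

Definition complete X Y : Prop := forall A : C,
  (exists (M N : C) (f : hom N M) (g : hom M A),
     [/\ short_exact f g, X M & Y N]) /\
  (exists (M N : C) (f : hom A N) (g : hom N M),
     [/\ short_exact f g, X M & Y N]).

Definition complete_cotorsion_pair X Y : Prop :=
  cotorsion_pair X Y /\ complete X Y.

Definition complete_hereditary_cotorsion_pair X Y : Prop :=
  complete_cotorsion_pair X Y /\ hereditary X Y.

(* The least element of P in the extended naturals, None standing for
   infinity. *)
Definition least (P : nat -> Prop) : option nat :=
  if pselect (exists n, `[< P n >]) is left h then Some (ex_minn h) else None.

Definition resdim X A : option nat :=
  least (fun n => exists P : resolution n A,
    forall i, (i <= n)%N -> X (res_ob P i)).

Definition coresdim X A : option nat :=
  least (fun n => exists I : coresolution n A,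
    forall i, (i <= n)%N -> X (cores_ob I i)).

Definition dim_finite (d : option nat) : Prop := exists n, d = Some n.

Definition sup_finite (dim : C -> option nat) : Prop :=
  exists N, forall A, exists2 n, dim A = Some n & (n <= N)%N.

Record thick W : Prop := Thick {
  thick_summand : forall A1 A2 B (i1 : hom A1 B) (i2 : hom A2 B)
    (p1 : hom B A1) (p2 : hom B A2),
    is_biproduct i1 i2 p1 p2 -> W B -> W A1;
  thick_extension : forall A B D (f : hom A B) (g : hom B D),
    short_exact f g -> W A -> W D -> W B;
  thick_kernel : forall A B D (f : hom A B) (g : hom B D),
    short_exact f g -> W B -> W D -> W A;
  thick_cokernel : forall A B D (f : hom A B) (g : hom B D),
    short_exact f g -> W A -> W B -> W D
}.

Definition hovey_triple Q W R : Prop :=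
  [/\ thick W, complete_cotorsion_pair Q (W `&` R)
    & complete_cotorsion_pair (Q `&` W) R].

End Cotorsion.

(* Main.v *)
(* A resolving class X with enough epimorphisms from its objects admits a
   dimension theory without Ext: comparing two syzygies over a pullback shows
   that, if A has X-dimension at most n + 1, every syzygy of A has dimension at
   most n, whatever cover was chosen.  Hence the objects of finite X-dimension
   form a thick class, and this applies to X = Qt.

   If A in Q has finite Qt-dimension, then inductively 0 -> K -> P -> A -> 0
   with K, P in Qt; pushing out along K -> I with I in R and cokernel in Qt
   gives 0 -> I -> E -> A -> 0 with E in Qt, which splits since I is in Qt & R, hence
   in Rt.  So A is in Qt.  If A in R has finite Qt-dimension, special
   Qt-precovers have kernel and middle term in R, and induction gives A in Rt.
   If A is in Rt, the special Q-precovers of A and of its syzygies have terms in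
   Q & Rt, hence in Qt, and the N-th syzygy is in Q when all Q-dimensions are
   at most N.  Thus Q & W = Qt and W & R = Rt.

   Everything used about the cotorsion pairs is self-dual once phrased with
   split short exact sequences, so the second half is the first one in the
   opposite category. *)

From mathcomp Require Import all_boot all_algebra.
From mathcomp Require Import boolp classical_sets.
From Stdlib Require Import Relation_Operators.
Require Import Defs.

Set Implicit Arguments.
Unset Strict Implicit.
Unset Printing Implicit Defensive.

Import GRing.Theory.
Local Open Scope classical_set_scope.
Local Open Scope ring_scope.
Local Open Scope cat_scope.

(** * Additive calculus of morphisms, monomorphisms, epimorphisms and kernels *)

Section Preadditive.
Variable C : preadditive.
Implicit Types A B D K T : C.

Lemma comp0m A B D (f : hom A B) : (0 : hom B D) ∘ f = 0.
Proof. by apply: (addrI (0 ∘ f)); rewrite -composeDl !addr0. Qed.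

Lemma compm0 A B D (f : hom B D) : f ∘ (0 : hom A B) = 0.
Proof. by apply: (addrI (f ∘ 0)); rewrite -composeDr !addr0. Qed.

Lemma compNm A B D (g : hom B D) (f : hom A B) : (- g) ∘ f = - (g ∘ f).
Proof. by apply/eqP; rewrite -addr_eq0 -composeDl addNr comp0m. Qed.

Lemma compmN A B D (g : hom B D) (f : hom A B) : g ∘ (- f) = - (g ∘ f).
Proof. by apply/eqP; rewrite -addr_eq0 -composeDr addNr compm0. Qed.

Lemma compBm A B D (g g' : hom B D) (f : hom A B) :
  (g - g') ∘ f = g ∘ f - g' ∘ f.
Proof. by rewrite composeDl compNm. Qed.

Lemma compmB A B D (g : hom B D) (f f' : hom A B) :
  g ∘ (f - f') = g ∘ f - g ∘ f'.
Proof. by rewrite composeDr compmN. Qed.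

Lemma mono0P A B (f : hom A B) :
  mono f <-> forall T (u : hom T A), f ∘ u = 0 -> u = 0.
Proof.
split=> [fM T u fu0|f0 T u v fuv]; first by apply: fM; rewrite fu0 compm0.
by apply/eqP; rewrite -subr_eq0; apply/eqP/f0; rewrite compmB fuv subrr.
Qed.

Lemma epi0P A B (f : hom A B) :
  epi f <-> forall T (u : hom B T), u ∘ f = 0 -> u = 0.
Proof.
split=> [fE T u uf0|f0 T u v uvf]; first by apply: fE; rewrite uf0 comp0m.
by apply/eqP; rewrite -subr_eq0; apply/eqP/f0; rewrite compBm uvf subrr.
Qed.

Lemma mono_id A : mono (idmor A).
Proof. by move=> T u v; rewrite !compose1m. Qed.

Lemma epi_id A : epi (idmor A).
Proof. by move=> T u v; rewrite !composem1. Qed.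

Lemma mono_comp A B D (g : hom B D) (f : hom A B) :
  mono g -> mono f -> mono (g ∘ f).
Proof. by move=> gM fM T u v; rewrite -!composeA => /gM/fM. Qed.

Lemma epi_comp A B D (g : hom B D) (f : hom A B) :
  epi g -> epi f -> epi (g ∘ f).
Proof. by move=> gE fE T u v; rewrite !composeA => /fE/gE. Qed.

Lemma mono_compr A B D (g : hom B D) (f : hom A B) : mono (g ∘ f) -> mono f.
Proof. by move=> gfM T u v fuv; apply: gfM; rewrite -!composeA fuv. Qed.

Lemma epi_compl A B D (g : hom B D) (f : hom A B) : epi (g ∘ f) -> epi g.
Proof. by move=> gfE T u v ugv; apply: gfE; rewrite !composeA ugv. Qed.

Lemma iso_mono A B (f : hom A B) : iso f -> mono f.
Proof.
by case=> g [gf _]; apply: (@mono_compr _ _ _ g); rewrite gf; apply: mono_id.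
Qed.

Lemma iso_epi A B (f : hom A B) : iso f -> epi f.
Proof.
by case=> g [_ fg]; apply: (@epi_compl _ _ _ _ g); rewrite fg; apply: epi_id.
Qed.

Lemma kernel_mono A B K (f : hom A B) (k : hom K A) : is_kernel f k -> mono k.
Proof.
move=> [fk0 kU] T u v kuv.
have fkv : f ∘ (k ∘ v) = 0 by rewrite composeA fk0 comp0m.
by have [w [_ wU]] := kU _ _ fkv; rewrite -(wU u kuv) -(wU v erefl).
Qed.

Lemma kernelP A B K (f : hom A B) (k : hom K A) :
  is_kernel f k <->
  [/\ mono k, f ∘ k = 0
    & forall T (t : hom T A), f ∘ t = 0 -> exists u, k ∘ u = t].
Proof.
split=> [kK|[kM fk kL]].
  split; [exact: kernel_mono kK | exact: kK.1 |].
  by move=> T t /(kK.2 _)[u [ku _]]; exists u.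
split=> // T t /kL[u ku]; exists u; split=> // v kv.
by apply: kM; rewrite ku.
Qed.

Lemma is_zeroP A T (f : hom A T) : is_zero A -> f = 0.
Proof. by move=> /(_ T)[+ _]; apply. Qed.

Lemma is_zeroP' A T (f : hom T A) : is_zero A -> f = 0.
Proof. by move=> /(_ T)[_ +]; apply. Qed.

End Preadditive.

(** * The opposite category *)

Definition op_preadditive (C : preadditive) : preadditive :=
  @Preadditive (ob C) (fun A B => hom B A) (fun A => idmor A)
    (fun A B D g f => f ∘ g)
    (fun A B f => composem1 f) (fun A B f => compose1m f)
    (fun A B D E h g f => esym (composeA f g h))
    (fun A B D g g' f => composeDr f g g')
    (fun A B D g f f' => composeDl f f' g).

Lemma biproduct_op (C : preadditive) (A1 A2 B : C) (i1 : hom A1 B)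
    (i2 : hom A2 B) (p1 : hom B A1) (p2 : hom B A2) :
  is_biproduct i1 i2 p1 p2 ->
  @is_biproduct (op_preadditive C) A1 A2 B p1 p2 i1 i2.
Proof. by case=> p11 p22 p12 p21 iE; split. Qed.

Lemma op_is_abelian (C : abelian_category) : is_abelian (op_preadditive C).
Proof.
have [zC bC kC cC mC eC] := abelianP C.
split.
- by have [Z ZP] := zC; exists Z => T; have [] := ZP T.
- move=> A1 A2; have [B [i1 [i2 [p1 [p2 BP]]]]] := bC A1 A2.
  by exists B, p1, p2, i1, i2; apply: biproduct_op.
- by move=> A B f; apply: cC.
- by move=> A B f; apply: kC.
- by move=> A B f fM; have [D [g gP]] := eC _ _ _ fM; exists D, g.
- by move=> A B f fE; have [D [g gP]] := mC _ _ _ fE; exists D, g.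
Qed.

Definition op (C : abelian_category) : abelian_category :=
  AbelianCategory (op_is_abelian C).

(** * Pullbacks, images and exactness in an abelian category *)

Definition is_pullback (C : preadditive) (A B D P : C) (g : hom A D)
    (h : hom B D) (p : hom P A) (q : hom P B) : Prop :=
  [/\ g ∘ p = h ∘ q,
      forall (T : C) (x : hom T A) (y : hom T B), g ∘ x = h ∘ y ->
        exists2 u : hom T P, p ∘ u = x & q ∘ u = y
    & forall (T : C) (u : hom T P), p ∘ u = 0 -> q ∘ u = 0 -> u = 0].

Section Abelian.
Variable C : abelian_category.
Implicit Types A B D K T : C.

(** The epimorphism [g] is the cokernel of some [h]. As [g] kills [h], [h] factors through the
    kernel [k], so whatever kills [k] also kills [h]. *)
Lemma epi_cokernel A B K (g : hom A B) (k : hom K A) :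
  epi g -> is_kernel g k -> is_cokernel k g.
Proof.
move=> gE gk; split; first exact: gk.1.
have [D [h [gh0 hU]]] := abelian_epi (abelianP C) gE.
have [_ _ /(_ _ _ gh0)[u hE]] := (kernelP _ _).1 gk.
move=> T t tk0; apply: hU.
by rewrite -hE composeA tk0 comp0m.
Qed.

Lemma pullback_sym A B D P (g : hom A D) (h : hom B D) (p : hom P A)
    (q : hom P B) : is_pullback g h p q -> is_pullback h g q p.
Proof.
case=> gphq lft jm; split=> // [T x y /esym/lft[u]|T u qu pu]; last exact: jm.
by exists u.
Qed.

(** The pullback is the kernel of [w] on the biproduct. If [g] is epi, so is [w], which is then the
    cokernel of [k]: when [t] kills [q], [t ∘ p2] factors through [w], and restricting to [A] shows
    that the factor [s] vanishes. *)
Lemma pullback_epi_ex A B D (g : hom A D) (h : hom B D) :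
  exists P (p : hom P A) (q : hom P B), is_pullback g h p q /\ (epi g -> epi q).
Proof.
have [S [i1 [i2 [p1 [p2 [p11 p22 p12 p21 iE]]]]]] :=
  abelian_biproduct (abelianP C) A B.
pose w := g ∘ p1 - h ∘ p2.
have [P [k kw]] := abelian_kernel (abelianP C) w.
have [kM wk0 kL] := (kernelP _ _).1 kw.
exists P, (p1 ∘ k), (p2 ∘ k); split; first split.
- by apply/eqP; rewrite !composeA -subr_eq0 -compBm; apply/eqP.
- move=> T x y gxhy; have [|u ku] := kL T (i1 ∘ x + i2 ∘ y).
    rewrite compBm !composeDr -!composeA (composeA p1) (composeA p1 i2).
    rewrite (composeA p2) (composeA p2 i2) p11 p12 p21 p22.
    by rewrite !compose1m !comp0m !compm0 addr0 add0r gxhy subrr.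
  exists u; rewrite -composeA ku composeDr !composeA ?p11 ?p12 ?p21 ?p22.
    by rewrite compose1m comp0m addr0.
  by rewrite compose1m comp0m add0r.
- move=> T u pu qu; move/mono0P: kM; apply.
  rewrite -[k]compose1m -iE composeDl composeDl -!composeA.
  by rewrite !(composeA _ k) pu qu !compm0 addr0.
move=> gE; have wi1 : w ∘ i1 = g.
  by rewrite compBm -!composeA p11 p21 composem1 compm0 subr0.
have wE : epi w by apply: (@epi_compl _ _ _ _ _ i1); rewrite wi1.
have [_ wU] := epi_cokernel wE kw.
apply/epi0P => T t; rewrite composeA => /(wU _ _)[s [sw _]].
have s0 : s = 0.
  by move/epi0P: gE; apply; rewrite -wi1 composeA sw -composeA p21 compm0.
by rewrite -[t]composem1 -p22 composeA -sw s0 !comp0m.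
Qed.

Lemma pullback_epi A B D P (g : hom A D) (h : hom B D) (p : hom P A)
    (q : hom P B) : is_pullback g h p q -> epi g -> epi q.
Proof.
move=> [_ lft _] gE.
have [P' [p' [q' [[gp' _ _] /(_ gE) q'E]]]] := pullback_epi_ex g h.
have [u _ qu] := lft _ _ _ gp'.
by apply: (@epi_compl _ _ _ _ _ u); rewrite qu.
Qed.

Lemma pullback_ex A B D (g : hom A D) (h : hom B D) :
  exists P (p : hom P A) (q : hom P B), is_pullback g h p q.
Proof.
by have [P [p [q [pq _]]]] := pullback_epi_ex g h; exists P, p, q.
Qed.

Lemma epi_lift A B T (g : hom A B) (x : hom T B) : epi g ->
  exists T' (e : hom T' T) (y : hom T' A), epi e /\ g ∘ y = x ∘ e.
Proof.
move=> gE; have [P [p [q pq]]] := pullback_ex g x.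
exists P, q, p; split; [exact: pullback_epi pq gE | by case: pq].
Qed.

(** If [t] kills [f'], then [f] factors through the subobject [k ∘ m] with [m] the kernel of [t].
    This subobject is the kernel of some [h]; as [h] kills [f], it factors through [c] and so kills
    [k]. Hence [k] factors through [k ∘ m], [m] has a section and [t = 0]. *)
Lemma image_epi A B D K (f : hom A B) (c : hom B D) (k : hom K B)
    (f' : hom A K) :
  is_cokernel f c -> is_kernel c k -> k ∘ f' = f -> epi f'.
Proof.
move=> [cf cU] kc kf'; have kM := kernel_mono kc.
apply/epi0P => T t tf0.
have [M [m mt]] := abelian_kernel (abelianP C) t.
have [mM tm mL] := (kernelP _ _).1 mt.
have [f'' mf''] := mL _ _ tf0.
have [E [h hk]] := abelian_mono (abelianP C) (mono_comp kM mM).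
have [_ hkm hL] := (kernelP _ _).1 hk.
have hf : h ∘ f = 0 by rewrite -kf' -mf'' !composeA -(composeA h) hkm comp0m.
have [h' [hE _]] := cU _ _ hf.
have [|n kmn] := hL _ k; first by rewrite -hE -composeA kc.1 compm0.
have mn : m ∘ n = idmor K by apply: kM; rewrite composeA kmn composem1.
by rewrite -[t]composem1 -mn composeA tm comp0m.
Qed.

(* Generalized elements: elements of B are morphisms T -> B, and surjectivity
   holds up to an epimorphic change of T. *)
Lemma exactP A B D (f : hom A B) (g : hom B D) :
  exact f g <->
  g ∘ f = 0 /\ forall T (x : hom T B), g ∘ x = 0 ->
    exists T' (e : hom T' T) (y : hom T' A), epi e /\ f ∘ y = x ∘ e.
Proof.
split=> [[K [k [[E [c [cf ck]]] kg]]]|[gf0 lft]].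
  have [kM gk gL] := (kernelP _ _).1 kg.
  have [_ _ cL] := (kernelP _ _).1 ck.
  have [f' kf'] := cL _ _ cf.1.
  have f'E := image_epi cf ck kf'.
  split=> [|T x /gL[z kz]]; first by rewrite -kf' composeA gk comp0m.
  have [T' [e [y [eE fy]]]] := epi_lift z f'E.
  by exists T', e, y; split=> //; rewrite -kf' -kz -!composeA fy.
have [K [k kg]] := abelian_kernel (abelianP C) g.
have [kM gk gL] := (kernelP _ _).1 kg.
have [E [c cf]] := abelian_cokernel (abelianP C) f.
exists K, k; split=> //; exists E, c; split=> //.
apply/kernelP; split=> // [|T t ct].
  have [T' [e [y [eE fy]]]] := lft _ _ gk.
  by move/epi0P: eE; apply; rewrite -composeA -fy composeA cf.1 comp0m.
have [g' [gc _]] := cf.2 _ _ gf0.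
by apply: gL; rewrite -gc -composeA ct compm0.
Qed.

Lemma short_exactP A B D (f : hom A B) (g : hom B D) :
  short_exact f g <->
  [/\ mono f, epi g, g ∘ f = 0
    & forall T (x : hom T B), g ∘ x = 0 ->
    exists T' (e : hom T' T) (y : hom T' A), epi e /\ f ∘ y = x ∘ e].
Proof.
split=> [[fM /exactP[gf fl] gE]|[fM gE gf fl]] //.
by split=> //; apply/exactP.
Qed.

(** The monomorphism [f] is the kernel of some [h], and [h] factors through the cokernel of [f]. So
    [h] kills the image [k], which therefore factors through [f]. *)
Lemma short_exact_kernel A B D (f : hom A B) (g : hom B D) :
  short_exact f g <-> is_kernel g f /\ epi g.
Proof.
split=> [[fM [K [k [[E [c [cf ck]]] kg]]] gE]|[fg gE]].
  split=> //; have [kM gk gL] := (kernelP _ _).1 kg.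
  have [_ _ cL] := (kernelP _ _).1 ck.
  have [f' kf'] := cL _ _ cf.1.
  have f'E := image_epi cf ck kf'.
  have gf : g ∘ f = 0 by rewrite -kf' composeA gk comp0m.
  have [E' [h hf]] := abelian_mono (abelianP C) fM.
  have [h' [h'c _]] := cf.2 _ _ hf.1.
  apply/kernelP; split=> // T t /gL[u ku].
  have [_ _ hL] := (kernelP _ _).1 hf.
  by apply: hL; rewrite -h'c -ku -composeA (composeA c) ck.1 comp0m compm0.
have [fM gf fL] := (kernelP _ _).1 fg.
apply/short_exactP; split=> // T x /fL[u fu].
by exists T, (idmor T), u; rewrite composem1; split=> //; apply: epi_id.
Qed.

Lemma short_exact_lift A B D T (f : hom A B) (g : hom B D) (x : hom T B) :
  short_exact f g -> g ∘ x = 0 -> exists u, f ∘ u = x.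
Proof.
by move=> /short_exact_kernel[/kernelP[_ _ fL] _] /fL.
Qed.

Lemma short_exact0 A B D (f : hom A B) (g : hom B D) :
  short_exact f g -> g ∘ f = 0.
Proof. by case/short_exactP. Qed.

Lemma short_exact_desc A B D T (f : hom A B) (g : hom B D) (x : hom B T) :
  short_exact f g -> x ∘ f = 0 -> exists u, u ∘ g = x.
Proof.
move=> /short_exact_kernel[gf gE] xf.
by have [_ /(_ _ _ xf)[u [ug _]]] := epi_cokernel gE gf; exists u.
Qed.

Lemma short_exact_op A B D (f : hom A B) (g : hom B D) :
  short_exact f g -> @short_exact (op C) D B A g f.
Proof.
move=> /short_exact_kernel[fg gE]; split.
- exact: gE.
- exists D, g; split; last exact: epi_cokernel.
  exists A, f; split; first exact: fg.
  exact: epi_cokernel.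
- exact: kernel_mono fg.
Qed.

(** Exactness is witnessed by a kernel [k] of [g] and a cokernel [c] of [f] such that [k] is a
    kernel of [c]. Duality exchanges [k] and [c], and [c] is a cokernel of [k] because it is epi. *)
Lemma exact_op A B D (f : hom A B) (g : hom B D) :
  exact f g -> @exact (op C) D B A g f.
Proof.
move=> [K [k [[E [c [cf ck]]] kg]]]; exists E, c; split=> //.
exists K, k; split=> //.
apply: epi_cokernel => //.
by apply: (@kernel_mono (op_preadditive C) _ _ _ f c).
Qed.

End Abelian.

Lemma op_short_exact (C : abelian_category) (A B D : C) (f : hom A B)
    (g : hom B D) :
  @short_exact (op C) D B A g f -> short_exact f g.
Proof.
move=> /short_exact_kernel[gf fM].
apply/short_exact_kernel; split.
  by apply: (@epi_cokernel (op C)).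
by apply: (@kernel_mono (op_preadditive C) _ _ _ f g).
Qed.


(** The vanishing of Ext^1(A, B) without Yoneda classes, by [Ext1_zero_split]. It is self-dual,
    since a section of [g] yields a retraction of [f]. *)
Definition all_split (C : preadditive) (A B : C) : Prop :=
  forall (E : C) (f : hom B E) (g : hom E A), short_exact f g ->
    exists s, g ∘ s = idmor A.

(** * Split extensions and their behaviour under pullback *)

Section Splitting.
Variable C : abelian_category.
Implicit Types A B D E K P T : C.

Lemma section_biproduct A B E (f : hom B E) (g : hom E A) s :
  short_exact f g -> g ∘ s = idmor A -> exists r, is_biproduct f s r g.
Proof.
move=> fg gs; have [fM gE gf _] := (short_exactP _ _).1 fg.
have [|r fr] := @short_exact_lift _ _ _ _ _ _ _ (idmor E - s ∘ g) fg.
  by rewrite compmB composem1 composeA gs compose1m subrr.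
exists r; split=> //.
- apply: fM; rewrite composeA fr compBm -composeA gf compm0.
  by rewrite compose1m composem1 subr0.
- apply: fM; rewrite composeA fr compBm -composeA gs compm0.
  by rewrite compose1m composem1 subrr.
- by rewrite fr subrK.
Qed.

Lemma section_retraction A B E (f : hom B E) (g : hom E A) :
  short_exact f g -> (exists s, g ∘ s = idmor A) ->
  exists r, r ∘ f = idmor B.
Proof.
by move=> fg [s /(section_biproduct fg)[r [rf _ _ _ _]]]; exists r.
Qed.

Lemma short_exact_biproduct A B E (i1 : hom A E) (i2 : hom B E)
  (p1 : hom E A) (p2 : hom E B) :
  is_biproduct i1 i2 p1 p2 -> short_exact i1 p2.
Proof.
case=> p11 p22 p12 p21 iE; apply/short_exact_kernel; split; last first.
  by apply: (@epi_compl _ _ _ _ _ i2); rewrite p22; apply: epi_id.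
apply/kernelP; split=> //.
  by apply: (@mono_compr _ _ _ _ p1); rewrite p11; apply: mono_id.
move=> T t p2t; exists (p1 ∘ t).
by rewrite -[RHS]compose1m -iE composeDl -!composeA p2t compm0 addr0.
Qed.

Lemma biproduct_sym A B E (i1 : hom A E) (i2 : hom B E)
  (p1 : hom E A) (p2 : hom E B) :
  is_biproduct i1 i2 p1 p2 -> is_biproduct i2 i1 p2 p1.
Proof. by case=> *; split=> //; rewrite addrC. Qed.

Lemma pullback_short_exact A B D K P (g : hom A D) (h : hom B D) (p : hom P A)
    (q : hom P B) (f : hom K A) :
  is_pullback g h p q -> short_exact f g ->
  exists2 f' : hom K P, short_exact f' q & p ∘ f' = f.
Proof.
move=> pq fg; have [gp lft jm] := pq; have [fM gE gf _] := (short_exactP _ _).1 fg.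
have [|f' pf' qf'] := lft _ f 0; first by rewrite gf compm0.
exists f' => //; apply/short_exact_kernel; split; last exact: pullback_epi pq gE.
apply/kernelP; split=> [||T t qt] //.
  by apply: (@mono_compr _ _ _ _ p); rewrite pf'.
have [|u fu] := @short_exact_lift _ _ _ _ _ _ _ (p ∘ t) fg.
  by rewrite composeA gp -composeA qt compm0.
exists u; apply/eqP; rewrite -subr_eq0; apply/eqP; apply: jm.
  by rewrite compmB composeA pf' fu subrr.
by rewrite compmB composeA qf' comp0m qt subrr.
Qed.

Lemma short_exact_pullback2 A B D K L (g : hom A D) (h : hom B D)
    (f : hom K A) (l : hom L B) :
  short_exact f g -> short_exact l h ->
  exists P (p : hom P A) (q : hom P B) (f' : hom K P) (l' : hom L P),
    short_exact f' q /\ short_exact l' p.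
Proof.
move=> fg lh; have [P [p [q pq]]] := pullback_ex g h.
have [f' f'q _] := pullback_short_exact pq fg.
have [l' l'p _] := pullback_short_exact (pullback_sym pq) lh.
by exists P, p, q, f', l'.
Qed.

(** A section of the extension pulled back along [x], followed by the projection to [E], is a lift
    of [x]. *)
Lemma all_split_lift B E M T (f : hom B E) (g : hom E M) (x : hom T M) :
  all_split T B -> short_exact f g -> exists y, g ∘ y = x.
Proof.
move=> TB fg; have [P [p [q pq]]] := pullback_ex g x.
have [f' f'q _] := pullback_short_exact pq fg.
have [s qs] := TB _ _ _ f'q.
by exists (p ∘ s); case: pq => gp _ _; rewrite composeA gp -composeA qs composem1.
Qed.

Lemma kernel_comp_short_exact A B D K P (l : hom K P) (p : hom P B)
    (a : hom A B) (b : hom B D) :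
  short_exact l p -> short_exact a b ->
  exists E (j : hom E P) (l' : hom K E) (q : hom E A),
    [/\ short_exact j (b ∘ p), short_exact l' q, p ∘ j = a ∘ q & j ∘ l' = l].
Proof.
move=> lp ab; have [aM bE ba _] := (short_exactP _ _).1 ab.
have [E [j [q pq]]] := pullback_ex p a.
have [l' l'q jl'] := pullback_short_exact pq lp.
have [pj lft jm] := pq.
exists E, j, l', q; split=> //; apply/short_exact_kernel; split.
  apply/kernelP; split.
  - apply/mono0P => T u ju; apply: jm => //; move/mono0P: aM; apply.
    by rewrite composeA -pj -composeA ju compm0.
  - by rewrite -composeA pj composeA ba comp0m.
  move=> T t; rewrite -composeA => /(short_exact_lift ab)[u au].
  by have [|v jv _] := lft _ t u; [rewrite au | exists v].
by apply: epi_comp => //; case/short_exactP: lp.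
Qed.

End Splitting.

Lemma all_split_op (C : abelian_category) (A B : C) :
  all_split A B -> @all_split (op C) B A.
Proof.
by move=> AB E g f /op_short_exact fg; apply: section_retraction (AB _ _ _ fg).
Qed.

Section ClosureProperties.
Variable C : abelian_category.
Implicit Types (A B D E K P M N : C) (X Y : set C).

Lemma all_split_summand A1 A2 B N (i1 : hom A1 B) (i2 : hom A2 B)
    (p1 : hom B A1) (p2 : hom B A2) :
  is_biproduct i1 i2 p1 p2 -> all_split B N -> all_split A1 N.
Proof.
move=> [p11 _ _ _ _] BN E f g fg; have [y gy] := all_split_lift p1 BN fg.
by exists (y ∘ i1); rewrite composeA gy.
Qed.

(** Over [A] there is a partial section [s] of [g]. Its cokernel [L] is an extension of [D] by [N],
    so [L] retracts onto [N]; composing with [c] retracts [E] onto [N]. *)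
Lemma all_split_extension A B D N (a : hom A B) (b : hom B D) :
  short_exact a b -> all_split A N -> all_split D N -> all_split B N.
Proof.
move=> ab AN DN E y g yg.
have [aM bE ba _] := (short_exactP _ _).1 ab.
have [yM gE gy yL] := (short_exactP _ _).1 yg.
have [s gs] := all_split_lift a AN yg.
have [L [c cs]] := abelian_cokernel (abelianP C) s.
have sM : mono s by apply: (@mono_compr _ _ _ _ g); rewrite gs.
have sc : short_exact s c.
  by apply: op_short_exact; apply/short_exact_kernel; split.
have [q qc] : exists q, q ∘ c = b ∘ g.
  by apply: short_exact_desc sc _; rewrite -composeA gs.
have yq : short_exact (c ∘ y) q.
  have cE : epi c by case/short_exactP: sc.
  apply/short_exactP; split.
  - apply/mono0P => T t; rewrite -composeA => /(short_exact_lift sc)[u su].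
    have u0 : u = 0.
      move/mono0P: aM; apply.
      by rewrite -gs -composeA su composeA gy comp0m.
    by move/mono0P: yM; apply; rewrite -su u0 compm0.
  - by apply: (@epi_compl _ _ _ _ _ c); rewrite qc; apply: epi_comp.
  - by rewrite composeA qc -composeA gy compm0.
  move=> T t qt.
  have [T' [e [x [eE cx]]]] := epi_lift t cE.
  have [|z az] := short_exact_lift (x := g ∘ x) ab.
    by rewrite composeA -qc -composeA cx composeA qt comp0m.
  have [|u yu] := short_exact_lift (x := x - s ∘ z) yg.
    by rewrite compmB (composeA g s) gs az subrr.
  exists T', e, u; split=> //.
  by rewrite -composeA yu compmB cx composeA (short_exact0 sc) comp0m subr0.
have [r rcy] := section_retraction yq (DN _ _ _ yq).
apply: (@section_retraction (op C) N B E g y); first exact: short_exact_op.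
by exists (r ∘ c); rewrite /= -composeA.
Qed.

End ClosureProperties.


(** * Building resolutions by splicing *)

Section Resolutions.
Variable C : abelian_category.
Implicit Types (A B E K P M N T Z : C).

Lemma exact_epi B K E P (p : hom B K) (k : hom K E) (g : hom E P) :
  epi p -> exact k g -> exact (k ∘ p) g.
Proof.
move=> pE /exactP[gk kL]; apply/exactP; split;
  first by rewrite composeA gk comp0m.
move=> T x /kL[T' [e [y [eE ky]]]].
have [T'' [e' [z [e'E pz]]]] := epi_lift y pE.
exists T'', (e ∘ e'), z; split; first exact: epi_comp.
by rewrite -composeA pz !composeA ky.
Qed.

Lemma exact_mono A B K E (f : hom A B) (k : hom B K) (h : hom K E) :
  mono h -> exact f k -> exact f (h ∘ k).
Proof.
move=> hM /exactP[kf fL]; apply/exactP; split.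
  by rewrite -composeA kf compm0.
by move=> T x; rewrite -composeA => hkx; apply: fL; move/mono0P: hM; apply.
Qed.

Lemma exact_to_mono Z A B (f : hom Z A) (g : hom A B) :
  is_zero Z -> exact f g -> mono g.
Proof.
move=> Z0 /exactP[_ fL]; apply/mono0P => T u /fL[T' [e [y [eE fy]]]].
by move/epi0P: eE; apply; rewrite -fy (is_zeroP' y Z0) compm0.
Qed.

(** Kept transparent, like [splice_resolution]: the terms and differentials of the extensions built
    from them are later identified by computation. *)
Definition trivial_resolution Z (Z0 : is_zero Z) A : resolution 0 A.
Proof.
refine (@Resolution _ 0 A (fun i => if i is 0%N then A else Z) (fun=> 0)
  (idmor A) (@epi_id _ A) _ _ _).
- apply/exactP; split; first by rewrite compm0.
  move=> T x; rewrite compose1m => ->.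
  by exists T, (idmor T), 0; rewrite compm0 comp0m; split=> //; apply: epi_id.
- move=> i; apply/exactP; split; first by rewrite compm0.
  move=> T x _; exists T, (idmor T), 0; rewrite compm0 (is_zeroP' x Z0) comp0m.
  by split=> //; apply: epi_id.
- by case.
Defined.

Definition splice_resolution n K P A (k : hom K P) (p : hom P A)
  (kp : short_exact k p) (r : resolution n K) : resolution n.+1 A.
Proof.
refine (@Resolution _ n.+1 A (fun i => if i is j.+1 then res_ob r j else P)
  (fun i => match i
     return hom (res_ob r i) (if i is j.+1 then res_ob r j else P) with
     | 0%N => k ∘ res_aug r | j.+1 => res_d r j end) p _ _ _ _).
- by case: kp.
- by case: (kp) => _ kpE _; exact: exact_epi (@res_epi _ _ _ r) kpE.
- case=> [|i]; last exact: res_exact.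
  by apply: exact_mono (res_exact0 r); case: kp.
- by case=> // i ni; apply: res_zero.
Defined.

End Resolutions.

Lemma iso_id (C : preadditive) (A : C) : iso (idmor A).
Proof. by exists (idmor A); rewrite compose1m. Qed.

(** * Vanishing of the Yoneda Ext^1 *)

Section ExtZero.
Variable C : abelian_category.
Implicit Types (A B E K P M N T Z : C).

Lemma ext_mono n A B (E : extension n.+1 A B) : mono (res_d E n ∘ ext_iota E).
Proof.
apply: mono_comp; last exact: iso_mono (ext_iso E).
case: n E => [|n] E.
  by apply: (exact_to_mono _ (res_exact E 0)); apply: res_zero.
by apply: (exact_to_mono _ (res_exact E n.+1)); apply: res_zero.
Qed.

Lemma ext1_short_exact A B (E : extension 1 A B) :
  short_exact (res_d E 0 ∘ ext_iota E) (res_aug E).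
Proof.
split; [exact: ext_mono| |exact: res_epi].
by apply: exact_epi (res_exact0 E); apply: iso_epi (ext_iso E).
Qed.

(** A map of extensions carries a section of [E] forward to [F], and a retraction of [F] back to
    [E]. *)
Lemma ext1_split_map A B (E F : extension 1 A B) : extension_map E F ->
  (exists s, res_aug E ∘ s = idmor A) <-> (exists s, res_aug F ∘ s = idmor A).
Proof.
move=> [f [fd fa fi]]; split=> [[s sE]|].
  by exists (f 0%N ∘ s); rewrite composeA fa.
move=> /(section_retraction (ext1_short_exact F))[r rE].
apply: (@section_retraction (op C) B A _ _ _ (short_exact_op (ext1_short_exact E))).
by exists (r ∘ f 0%N); rewrite /= -composeA (composeA (f 0%N)) fd -composeA fi.
Qed.

Lemma yoneda_invariant n A B (S : extension n A B -> Prop) :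
  (forall E F : extension n A B, extension_map E F -> S E <-> S F) ->
  forall E F : extension n A B, yoneda_equiv E F -> S E <-> S F.
Proof.
move=> Smap E F; elim=> {E F} [E F|E|E F _ EF|E F G _ EF _ FG].
- exact: Smap.
- by [].
- by split=> /EF.
- by rewrite EF.
Qed.

Lemma zero_ex : exists Z : C, is_zero Z.
Proof. exact: abelian_zero (abelianP C). Qed.

(** If all extensions are equivalent, each is linked by a zigzag to the biproduct, and splitting is
    preserved along it. Conversely, two split extensions are joined by a single map, built from a
    retraction of the first and a section of the second. *)
Lemma Ext1_zero_split A B : Ext_zero 1 A B <-> all_split A B.
Proof.
have [Z Z0] := zero_ex.
split=> [AB M f g fg|AB E F].
  have [S [i1 [i2 [p1 [p2 bP]]]]] := abelian_biproduct (abelianP C) B A.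
  pose mk E' (f' : hom B E') (g' : hom E' A) (fg' : short_exact f' g') :=
    @Extension _ 1 A B (splice_resolution fg' (trivial_resolution Z0 B))
     (idmor B) (@iso_id _ B).
  have [_ ex] := yoneda_invariant (@ext1_split_map A B)
    (AB (mk _ _ _ fg) (mk _ _ _ (short_exact_biproduct bP))).
  by apply: ex; exists i2; case: bP.
have [s sE] := AB _ _ _ (ext1_short_exact E).
have [t tF] := AB _ _ _ (ext1_short_exact F).
have [r [rE aE rs _ iE]] := section_biproduct (ext1_short_exact E) sE.
have [j [ij ji]] := ext_iso E.
have ae0 := short_exact0 (ext1_short_exact E).
have af0 := short_exact0 (ext1_short_exact F).
apply: rst_step.
pose f0 := res_d F 0 ∘ ext_iota F ∘ r + t ∘ res_aug E.
(* In degree 1 both terms are copies of [B], and the identity on [B] forces [ext_iota F] after the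
   inverse [j] of [ext_iota E]. Higher terms vanish. *)
exists (fun i => match i return hom (res_ob E i) (res_ob F i) with
  | 0%N => f0 | 1%N => ext_iota F ∘ j | _ => 0 end); split.
- case=> [|[|i]]; last 2 first.
  + by rewrite compm0 (is_zeroP (res_d E 1)) ?compm0 //; apply: res_zero.
  + by rewrite comp0m compm0.
  apply: (iso_epi (ext_iso E)).
  rewrite -!composeA ij composem1 /f0 composeDl -!composeA ae0 compm0 addr0.
  by rewrite rE composem1.
- by rewrite composeDr (composeA (res_aug F) t) tF compose1m composeA af0
    comp0m add0r.
- by rewrite -composeA ij composem1.
Qed.

End ExtZero.


(** * Vanishing of the Yoneda Ext^2 and dimension shifting *)

Section Ext2.
Variable C : abelian_category.
Implicit Types (A B D E K P M N T Z : C).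

(* For E = (0 -> B -> E1 -> E0 -> A -> 0) with K the image of E1 -> E0: the
   extension E1 of K by B is the restriction of an extension of E0 by B; by the
   long exact sequence this means that the class of E in Ext^2 vanishes. *)
Definition extends_over A B (E : extension 2 A B) : Prop :=
  exists F (u : hom (res_ob E 1) F) (g : hom F (res_ob E 0)),
    short_exact (u ∘ (res_d E 1 ∘ ext_iota E)) g /\ g ∘ u = res_d E 0.

Lemma ext2_exact1 A B (E : extension 2 A B) :
  exact (res_d E 1 ∘ ext_iota E) (res_d E 0).
Proof. by apply: exact_epi (res_exact E 0); apply: iso_epi (ext_iso E). Qed.

Lemma exact0 A B D (f : hom A B) (g : hom B D) : exact f g -> g ∘ f = 0.
Proof. by case/exactP. Qed.

Lemma exact_desc A B D T (f : hom A B) (g : hom B D) (t : hom B T) :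
  exact f g -> epi g -> t ∘ f = 0 -> exists u, u ∘ g = t.
Proof.
move=> /exactP[gf fL] gE tf0; have [K [k kg]] := abelian_kernel (abelianP C) g.
apply: (@short_exact_desc _ _ _ _ _ k); first exact/short_exact_kernel.
have [T' [e [y [eE fy]]]] := fL _ _ kg.1.
by move/epi0P: eE; apply; rewrite -composeA -fy composeA tf0 comp0m.
Qed.

Lemma pushout_ex A B D (g : hom D A) (h : hom D B) :
  exists P (p : hom A P) (q : hom B P),
    [/\ p ∘ g = q ∘ h,
      forall T (x : hom A T) (y : hom B T), x ∘ g = y ∘ h ->
        exists2 u : hom P T, u ∘ p = x & u ∘ q = y,
      forall T (u : hom P T), u ∘ p = 0 -> u ∘ q = 0 -> u = 0
    & mono g -> mono q].
Proof.
have [P [p [q [[pg lft jm] qM]]]] := @pullback_epi_ex (op C) A B D g h.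
by exists P, p, q.
Qed.

(** To go against a map of extensions, pull [G] back along [f 0]; the kernel inclusion is identified
    through its two projections. *)
Lemma extends_over_pullback A B (E F : extension 2 A B) :
  extension_map E F -> extends_over F -> extends_over E.
Proof.
move=> [f [fd fa fi]] [G [u [g [ug gu]]]].
have [H [a [h pH]]] := pullback_ex g (f 0%N).
have [k' k'h ak'] := pullback_short_exact pH ug.
have [ga lft jm] := pH.
have [|v av hv] := lft _ (u ∘ f 1%N) (res_d E 0).
  by rewrite composeA gu fd.
exists H, v, h; split=> //.
suff -> : v ∘ (res_d E 1 ∘ ext_iota E) = k' by [].
apply/eqP; rewrite -subr_eq0; apply/eqP; apply: jm; rewrite compmB composeA.
  by rewrite av ak' -!composeA (composeA (f 1%N)) fd -(composeA (res_d F 1)) fi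
      subrr.
by rewrite hv (short_exact0 k'h) (exact0 (ext2_exact1 E)) subrr.
Qed.

(** To go along a map of extensions, push [G] out along [f 1]. The work lies in proving that the
    pushout [H] is still an extension by [B]. *)
Lemma extends_over_pushout A B (E F : extension 2 A B) :
  extension_map E F -> extends_over E -> extends_over F.
Proof.
move=> [f [fd fa fi]] [G [u [g [ug gu]]]].
have [dE dF] := (ext2_exact1 E, ext2_exact1 F).
have [ugM gE gug ugL] := (short_exactP _ _).1 ug.
(* Whatever [u] kills is killed by the differential of [E], hence comes from [B], where [u] is
   mono. *)
have uM : mono u.
  apply/mono0P => T t ut.
  have /exactP[_ /(_ _ t)[|T' [e [y [eE dy]]]]] := dE.
    by rewrite -gu -composeA ut compm0.
  have y0 : y = 0.
    by move/mono0P: ugM; apply; rewrite -composeA dy composeA ut comp0m.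
  by move/epi0P: eE; apply; rewrite -dy y0 compm0.
have [H [a [v [avE lft jm /(_ uM) vM]]]] := pushout_ex u (f 1%N).
have [|h ha hv] := lft _ (f 0%N ∘ g) (res_d F 0).
  by rewrite -composeA gu fd.
exists H, v, h; split=> //; apply/short_exactP; split.
- by apply: mono_comp => //; apply: ext_mono.
- apply/epi0P => T t th.
  have tf0 : t ∘ f 0%N = 0.
    by move/epi0P: gE; apply; rewrite -composeA -ha composeA th comp0m.
  have td0 : t ∘ res_d F 0 = 0 by rewrite -hv composeA th comp0m.
  have [s st] := exact_desc (res_exact0 F) (@res_epi _ _ _ F) td0.
  suff -> : t = 0 by [].
  rewrite -st; suff -> : s = 0 by rewrite comp0m.
  move/epi0P: (@res_epi _ _ _ E); apply.
  by rewrite -fa composeA st tf0.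
- by rewrite composeA hv (exact0 dF).
move=> T x hx.
(* Up to an epimorphic change of [T], an element of the pushout is a sum [a ∘ y + v ∘ z], as the
   biproduct of [G] and the degree-one term of [F] maps onto [H]. *)
have [S [i1 [i2 [p1 [p2 [p11 p22 p12 p21 iE]]]]]] :=
  abelian_biproduct (abelianP C) G (res_ob F 1).
have wE : epi (a ∘ p1 + v ∘ p2).
  apply/epi0P => T' t; rewrite composeDr => tw.
  apply: jm => /=.
    have /(congr1 (fun z => z ∘ i1)) := tw.
    rewrite composeDl comp0m -!composeA p11 p21 !compm0 addr0 composem1.
    by [].
  have /(congr1 (fun z => z ∘ i2)) := tw.
  rewrite composeDl comp0m -!composeA p12 p22 !compm0 add0r composem1.
  by [].
have [T1 [e1 [w [e1E wx]]]] := epi_lift x wE.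
have : x ∘ e1 = a ∘ (p1 ∘ w) + v ∘ (p2 ∘ w) by rewrite -wx composeDl !composeA.
move: (p1 ∘ w) (p2 ∘ w) => y z xE.
have hyz : f 0%N ∘ (g ∘ y) + res_d F 0 ∘ z = 0.
  by rewrite composeA -ha -hv -!composeA -composeDr -xE composeA hx comp0m.
(* The augmentation kills [g ∘ y], which is thus locally a boundary of [E]; so [y] lies in the image
   of [u], and the [a]-part of [x] can be absorbed into [v ∘ z']. *)
have ay : res_aug E ∘ (g ∘ y) = 0.
  rewrite -fa -composeA (canRL (addrK _) hyz) sub0r compmN composeA.
  by rewrite (exact0 (res_exact0 F)) comp0m oppr0.
have [_ /(_ _ _ ay)[T2 [e2 [t [e2E dt]]]]] := (exactP _ _).1 (res_exact0 E).
have [|b bE] := short_exact_lift (x := y ∘ e2 - u ∘ t) ug.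
  by rewrite compmB !composeA gu dt subrr.
have yE : y ∘ e2 = u ∘ (t + res_d E 1 ∘ ext_iota E ∘ b).
  by rewrite composeDr composeA bE addrC subrK.
pose z' := f 1%N ∘ (t + res_d E 1 ∘ ext_iota E ∘ b) + z ∘ e2.
have xE' : x ∘ (e1 ∘ e2) = v ∘ z'.
  rewrite composeA xE composeDl -!composeA yE composeA avE.
  by rewrite -(composeA v) -composeDr.
have dz : res_d F 0 ∘ z' = 0.
  by rewrite -hv -composeA -xE' composeA hx comp0m.
have [_ /(_ _ _ dz)[T3 [e3 [b' [e3E b'E]]]]] := (exactP _ _).1 dF.
exists T3, (e1 ∘ e2 ∘ e3), b'; split.
  by do 2?apply: epi_comp.
by rewrite -composeA b'E !composeA -xE' !composeA.
Qed.

(** The Yoneda product of the two sequences is equivalent to the 2-fold extension with terms [B] and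
    [A] and zero middle map, which extends over the biproduct; [extends_over] is invariant under
    equivalence. *)
Lemma Ext2_zero_extends A B K E0 E1 (f : hom B E1) (g : hom E1 K)
    (k : hom K E0) (p : hom E0 A) :
  Ext_zero 2 A B -> short_exact f g -> short_exact k p ->
  exists F (u : hom E1 F) (h : hom F E0),
    short_exact (u ∘ f) h /\ h ∘ u = k ∘ g.
Proof.
have [Z Z0] := zero_ex C.
move=> AB fg kp.
have [S [i1 [i2 [p1 [p2 bP]]]]] := abelian_biproduct (abelianP C) B A.
have id0 M : short_exact (idmor M) (0 : hom M Z).
  apply/short_exactP; split=> //; first exact: mono_id.
  - by apply/epi0P => T u _; apply: is_zeroP.
  - by rewrite comp0m.
  by move=> T x _; exists T, (idmor T), x; rewrite compose1m composem1; split=> //;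
    apply: epi_id.
have zid M : short_exact (0 : hom Z M) (idmor M).
  apply/short_exact_kernel; split; last exact: epi_id.
  apply/kernelP; split; rewrite ?compm0 //.
    by move=> T u v _; rewrite (is_zeroP' u Z0) (is_zeroP' v Z0).
  by move=> T t; rewrite compose1m => ->; exists 0; rewrite comp0m.
pose mk M N L (b : hom B M) (c : hom M N) (d : hom N L) (q : hom L A)
  (bc : short_exact b c) (dq : short_exact d q) :=
    @Extension _ 2 A B
      (splice_resolution dq (splice_resolution bc (trivial_resolution Z0 B)))
     (idmor B) (@iso_id _ B).
have inv (G H : extension 2 A B) (GH : extension_map G H) :
    extends_over G <-> extends_over H.
  by split; [exact: extends_over_pushout|exact: extends_over_pullback].
have [_ ex] := yoneda_invariant inv
    (AB (mk _ _ _ _ _ _ _ fg kp) (mk _ _ _ _ _ _ _ (id0 B) (zid A))).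
have [|F [u [h []]]] := ex.
  exists S, i1, p2; split=> /=; last by rewrite comp0m; case: bP.
  rewrite !composem1; exact: short_exact_biproduct bP.
by rewrite /= !composem1; exists F, u, h.
Qed.

(** An extension of [K] by [B] is the restriction of one of [P] by [B], and a retraction of the
    latter restricts. *)
Lemma all_split_kernel A B K P (k : hom K P) (p : hom P A) :
  short_exact k p -> all_split P B -> Ext_zero 2 A B -> all_split K B.
Proof.
move=> kp PB AB E f g fg.
have [F [u [h [uh hu]]]] := Ext2_zero_extends AB fg kp.
have [r ruf] := section_retraction uh (PB _ _ _ uh).
apply: (@section_retraction (op C) B K E g f); first exact: short_exact_op.
by exists (r ∘ u); rewrite /= -composeA.
Qed.

(** The same object [F] is read dually, as an extension of [A] by [M] mapping to [E] over [A]; its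
    section followed by [g] is a section of [p]. *)
Lemma all_split_cokernel A B M N (b : hom B M) (c : hom M N) :
  short_exact b c -> all_split A M -> Ext_zero 2 A B -> all_split A N.
Proof.
move=> bc AM AB E f p fp.
have [F [u [g [ug gu]]]] := Ext2_zero_extends AB bc fp.
have [bM cE cb bL] := (short_exactP _ _).1 bc.
have [ubM gE gub ubL] := (short_exactP _ _).1 ug.
have [fM pE pf _] := (short_exactP _ _).1 fp.
have upg : short_exact u (p ∘ g).
  apply/short_exactP; split.
  - apply/mono0P => T t ut.
    have ct : c ∘ t = 0.
      move/mono0P: fM; apply; by rewrite composeA -gu -composeA ut compm0.
    have [y yt] := short_exact_lift bc ct.
    have y0 : y = 0 by move/mono0P: ubM; apply; rewrite -composeA yt.
    by rewrite -yt y0 compm0.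
  - exact: epi_comp.
  - by rewrite -composeA gu composeA pf comp0m.
  move=> T x; rewrite -composeA => pgx.
  have [y fy] := short_exact_lift fp pgx.
  have [T' [e [z [eE cz]]]] := epi_lift y cE.
  have [|w wE] := short_exact_lift (x := x ∘ e - u ∘ z) ug.
    by rewrite compmB !composeA gu -fy -(composeA f c) cz composeA subrr.
  exists T', e, (z + b ∘ w); split=> //.
  by rewrite composeDr composeA wE addrC subrK.
have [s gs] := AM _ _ _ upg.
by exists (g ∘ s); rewrite composeA.
Qed.

End Ext2.


(** * Resolving classes and hereditary pairs *)

Record resolving (C : preadditive) (X : set C) : Prop := Resolving {
  resolving_summand : forall (A1 A2 B : C) (i1 : hom A1 B) (i2 : hom A2 B)
    (p1 : hom B A1) (p2 : hom B A2),
    is_biproduct i1 i2 p1 p2 -> X B -> X A1;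
  resolving_extension : forall (A B D : C) (f : hom A B) (g : hom B D),
    short_exact f g -> X A -> X D -> X B;
  resolving_kernel : forall (A B D : C) (f : hom A B) (g : hom B D),
    short_exact f g -> X B -> X D -> X A
}.

(* The self-dual content of being a complete hereditary cotorsion pair, freed
   from Yoneda Ext. *)
Record hereditary_pair (C : abelian_category) (X Y : set C) : Prop :=
  HereditaryPair {
  pair_left : resolving X;
  pair_right : @resolving (op C) Y;
  pair_cover : forall A, exists (K P : C) (k : hom K P) (p : hom P A),
    [/\ short_exact k p, X P & Y K];
  pair_hull : forall A, exists (I L : C) (i : hom A I) (q : hom I L),
    [/\ short_exact i q, Y I & X L];
  pair_split : forall A B, X A -> Y B -> all_split A B
}.

(** As a record [op (op C)] is not convertible to [C], but its objects, morphisms and composition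
    are, so the fields can be repacked. *)
Lemma resolving_op_op (C : abelian_category) (X : set C) :
  resolving X -> @resolving (op (op C)) X.
Proof. by case=> s e k; split; [exact: s|exact: e|exact: k]. Qed.

Lemma hereditary_pair_op (C : abelian_category) (X Y : set C) :
  hereditary_pair X Y -> @hereditary_pair (op C) Y X.
Proof.
case=> l r c h s; split; [exact: r|exact: resolving_op_op| | |].
- move=> A; have [I [L [i [q [iq YI XL]]]]] := h A.
  by exists L, I, q, i; split=> //; exact: short_exact_op.
- move=> A; have [K [P [k [p [kp XP YK]]]]] := c A.
  by exists P, K, p, k; split=> //; exact: short_exact_op.
- by move=> A B YA XB; apply: all_split_op; apply: s.
Qed.

Section CotorsionPairs.
Variable C : abelian_category.
Implicit Types (A B : C) (X Y : set C).

Lemma cotorsion_pair_leftE X Y A : cotorsion_pair X Y ->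
  X A <-> forall B, Y B -> all_split A B.
Proof.
case=> _ XE; rewrite {1}XE; split=> H B YB; first exact/Ext1_zero_split/H.
by apply/Ext1_zero_split; apply: H.
Qed.

Lemma cotorsion_pair_rightE X Y B : cotorsion_pair X Y ->
  Y B <-> forall A, X A -> all_split A B.
Proof.
case=> YE _; rewrite -{1}YE; split=> H A XA; first exact/Ext1_zero_split/H.
by apply/Ext1_zero_split; apply: H.
Qed.

(** Ext^1 gives closure under summands and extensions on both sides. Dimension shifting through
    Ext^2 gives closure of [X] under kernels of epimorphisms and of [Y] under cokernels of
    monomorphisms. *)
Lemma complete_hereditary_pair X Y :
  complete_hereditary_cotorsion_pair X Y -> hereditary_pair X Y.
Proof.
move=> [[XY cXY] hXY]; split.
- split.
  + move=> A1 A2 B i1 i2 p1 p2 bP /(cotorsion_pair_leftE _ XY) XB.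
    apply/(cotorsion_pair_leftE _ XY) => N YN.
    exact: all_split_summand bP (XB _ YN).
  + move=> A B D f g fg /(cotorsion_pair_leftE _ XY) XA.
    move=> /(cotorsion_pair_leftE _ XY) XD.
    apply/(cotorsion_pair_leftE _ XY) => N YN.
    exact: all_split_extension fg (XA _ YN) (XD _ YN).
  + move=> A B D f g fg /(cotorsion_pair_leftE _ XY) XB XD.
    apply/(cotorsion_pair_leftE _ XY) => N YN.
    exact: all_split_kernel fg (XB _ YN) (hXY _ _ 2%N XD YN isT).
- split.
  + move=> A1 A2 B i1 i2 p1 p2 bP /(cotorsion_pair_rightE _ XY) YB.
    apply/(cotorsion_pair_rightE _ XY) => M XM.
    apply: (@all_split_op (op C)); apply: all_split_summand bP _.
    exact/all_split_op/YB.
  + move=> A B D f g fg /(cotorsion_pair_rightE _ XY) YA.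
    move=> /(cotorsion_pair_rightE _ XY) YD.
    apply/(cotorsion_pair_rightE _ XY) => M XM.
    apply: (@all_split_op (op C)); apply: all_split_extension fg _ _.
      exact/all_split_op/YA.
    exact/all_split_op/YD.
  + move=> A B D f g /op_short_exact fg /(cotorsion_pair_rightE _ XY) YB YD.
    apply/(cotorsion_pair_rightE _ XY) => M XM.
    exact: all_split_cokernel fg (YB _ XM) (hXY _ _ 2%N XM YD isT).
- by move=> A; have [[M [N [f [g fg]]]] _] := cXY A; exists N, M, f, g.
- move=> A; have [_ [M [N [f [g [fg XM YN]]]]]] := cXY A.
  by exists N, M, f, g.
- by move=> A B XA YB; move/(cotorsion_pair_leftE _ XY): XA; apply.
Qed.

End CotorsionPairs.

(** * Dimension relative to a resolving class, without Ext *)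

Section ResolutionDimension.
Variable C : abelian_category.
Implicit Types (A B D E K L P : C) (X : set C) (n m : nat).

(** A resolution of length [n] unfolded one syzygy at a time; for resolving [X] this agrees with the
    original notion by [resolution_resdim_le]. *)
Fixpoint resdim_le X n A : Prop :=
  if n is m.+1 then
    exists (K P : C) (k : hom K P) (p : hom P A),
      [/\ short_exact k p, X P & resdim_le X m K]
  else X A.

Variable X : set C.
Hypothesis resX : resolving X.
Hypothesis coverX : forall A, exists (K P : C) (k : hom K P) (p : hom P A),
  short_exact k p /\ X P.

(** In positive dimension [A] and [B] share a syzygy: if [P] covers [B] with kernel [K], the kernel
    of [P -> D] lies in [X] and covers [A] with the same kernel. *)
Lemma resdim_le_two_of_three n A B D (f : hom A B) (g : hom B D) :
  short_exact f g -> X D -> resdim_le X n A <-> resdim_le X n B.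
Proof.
(* Schanuel's argument: the pullback of the two covers is an extension of [P'] by [K] and of [P] by
   [K']. The case [m] of the lemma is an argument, so that it can serve inside the induction. *)
have syzygy m (IH : forall A B D (f : hom A B) (g : hom B D),
    short_exact f g -> X D -> resdim_le X m A <-> resdim_le X m B)
  K P A' (k : hom K P) (p : hom P A') :
  short_exact k p -> X P -> resdim_le X m.+1 A' -> resdim_le X m K.
  move=> kp XP [K' [P' [k' [p' [kp' XP' K'm]]]]].
  have [E [q [q' [i [i' [iq' iq]]]]]] := short_exact_pullback2 kp kp'.
  by apply/(IH _ _ _ _ _ iq' XP')/(IH _ _ _ _ _ iq XP).
elim: n A B D f g => [|n IH] A B D f g fg XD /=.
  split=> [XA|XB]; first exact: resolving_extension fg XA XD.
  exact: resolving_kernel fg XB XD.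
split=> [An|[K [P [k [p [kp XP Kn]]]]]].
  have [K [P [k [p [kp XP]]]]] := coverX B.
  have [E [j [l [q [jgp lq _ _]]]]] := kernel_comp_short_exact kp fg.
  have XE := resolving_kernel resX jgp XP XD.
  by exists K, P, k, p; split=> //; apply: syzygy lq XE An.
have [E [j [l [q [jgp lq _ _]]]]] := kernel_comp_short_exact kp fg.
by exists K, E, l, q; split=> //; apply: resolving_kernel jgp XP XD.
Qed.

Lemma resdim_le_syzygy n K P A (k : hom K P) (p : hom P A) :
  short_exact k p -> X P -> resdim_le X n.+1 A -> resdim_le X n K.
Proof.
move=> kp XP [K' [P' [k' [p' [kp' XP' K'm]]]]].
have [E [q [q' [i [i' [iq' iq]]]]]] := short_exact_pullback2 kp kp'.
by apply/(resdim_le_two_of_three _ iq' XP')/(resdim_le_two_of_three _ iq XP).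
Qed.

Lemma resdim_leS n A : resdim_le X n A -> resdim_le X n.+1 A.
Proof.
elim: n A => [|n IH] A /= => [XA|[K [P [k [p [kp XP /IH Kn]]]]]].
  have [K [P [k [p [kp XP]]]]] := coverX A.
  exists K, P, k, p; split=> //; exact: resolving_kernel kp XP XA.
by exists K, P, k, p.
Qed.

Definition resdim_fin A := exists n, resdim_le X n A.

Lemma resdim_fin_syzygy K P A (k : hom K P) (p : hom P A) :
  short_exact k p -> X P -> resdim_fin A -> resdim_fin K.
Proof.
by move=> kp XP [n /resdim_leS An]; exists n; apply: resdim_le_syzygy kp XP An.
Qed.

Lemma resdim_fin_quotient K P A (k : hom K P) (p : hom P A) :
  short_exact k p -> X P -> resdim_fin K -> resdim_fin A.
Proof. by move=> kp XP [n Kn]; exists n.+1, K, P, k, p. Qed.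

(** Induction on the dimension of [D]. The pullback [E] of [B] and a cover of [D] has finite
    dimension and maps onto [B] with kernel [K]. Covering [E] by [P'] makes [E2] a syzygy of [B] and
    an extension of [K] by a syzygy of [E]. *)
Lemma resdim_fin_extension A B D (f : hom A B) (g : hom B D) :
  short_exact f g -> resdim_fin A -> resdim_fin D -> resdim_fin B.
Proof.
move=> fg Afin [m]; elim: m A B D f g fg Afin => [|m IH] A B D f g fg [n An] /=.
  by move=> XD; exists n; apply/(resdim_le_two_of_three n fg XD).
move=> [K [P [k [p [kp XP Km]]]]].
have [E [q [q' [i [i' [iq' iq]]]]]] := short_exact_pullback2 fg kp.
have Efin : resdim_fin E.
  by exists n; apply/(resdim_le_two_of_three n iq' XP).
have [L [P' [l [r [lr XP']]]]] := coverX E.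
have [E2 [j [l' [s [jqr l's _ _]]]]] := kernel_comp_short_exact lr iq.
apply: (resdim_fin_quotient jqr XP'); apply: IH l's _ Km.
exact: resdim_fin_syzygy lr XP' Efin.
Qed.

(** Covering [B] also covers [D], and the resulting syzygy [E] of [D] is an extension of [A] by a
    syzygy of [B]. *)
Lemma resdim_fin_cokernel A B D (f : hom A B) (g : hom B D) :
  short_exact f g -> resdim_fin A -> resdim_fin B -> resdim_fin D.
Proof.
move=> fg Afin Bfin; have [L [P [l [p [lp XP]]]]] := coverX B.
have [E [j [l' [s [jgp l's _ _]]]]] := kernel_comp_short_exact lp fg.
apply: (resdim_fin_quotient jgp XP); apply: resdim_fin_extension l's _ Afin.
exact: resdim_fin_syzygy lp XP Bfin.
Qed.

(** The same diagram shows [A] as the cokernel of a map from a syzygy of [B] to a syzygy of [D]. *)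
Lemma resdim_fin_kernel A B D (f : hom A B) (g : hom B D) :
  short_exact f g -> resdim_fin B -> resdim_fin D -> resdim_fin A.
Proof.
move=> fg Bfin Dfin; have [L [P [l [p [lp XP]]]]] := coverX B.
have [E [j [l' [s [jgp l's _ _]]]]] := kernel_comp_short_exact lp fg.
apply: resdim_fin_cokernel l's _ _; first exact: resdim_fin_syzygy lp XP Bfin.
exact: resdim_fin_syzygy jgp XP Dfin.
Qed.

Lemma short_exact_sum K1 K2 P1 P2 A1 A2 B (k1 : hom K1 P1) (p1 : hom P1 A1)
    (k2 : hom K2 P2) (p2 : hom P2 A2) (i1 : hom A1 B) (i2 : hom A2 B)
    (r1 : hom B A1) (r2 : hom B A2) K P
    (x1 : hom K1 K) (x2 : hom K2 K) (y1 : hom K K1) (y2 : hom K K2)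
    (u1 : hom P1 P) (u2 : hom P2 P) (v1 : hom P P1) (v2 : hom P P2) :
  is_biproduct i1 i2 r1 r2 -> is_biproduct x1 x2 y1 y2 ->
  is_biproduct u1 u2 v1 v2 -> short_exact k1 p1 -> short_exact k2 p2 ->
  short_exact (u1 ∘ k1 ∘ y1 + u2 ∘ k2 ∘ y2) (i1 ∘ p1 ∘ v1 + i2 ∘ p2 ∘ v2).
Proof.
move=> [r11 r22 r12 r21 iE] [y11 y22 y12 y21 xE] [v11 v22 v12 v21 uE] kp1 kp2.
have [k1M p1E pk1 _] := (short_exactP _ _).1 kp1.
have [k2M p2E pk2 _] := (short_exactP _ _).1 kp2.
set k := u1 ∘ k1 ∘ y1 + u2 ∘ k2 ∘ y2; set p := i1 ∘ p1 ∘ v1 + i2 ∘ p2 ∘ v2.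
have v1k : v1 ∘ k = k1 ∘ y1.
  by rewrite composeDr !composeA v11 v12 !comp0m addr0 compose1m.
have v2k : v2 ∘ k = k2 ∘ y2.
  by rewrite composeDr !composeA v21 v22 !comp0m add0r compose1m.
have r1p : r1 ∘ p = p1 ∘ v1.
  by rewrite composeDr !composeA r11 r12 !comp0m addr0 compose1m.
have r2p : r2 ∘ p = p2 ∘ v2.
  by rewrite composeDr !composeA r21 r22 !comp0m add0r compose1m.
have pu1 : p ∘ u1 = i1 ∘ p1.
  by rewrite composeDl -!composeA v11 v21 !compm0 addr0 composem1.
have pu2 : p ∘ u2 = i2 ∘ p2.
  by rewrite composeDl -!composeA v12 v22 !compm0 add0r composem1.
apply/short_exact_kernel; split; last first.
  apply/epi0P => T t tp.
  have t1 : t ∘ i1 = 0.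
    by move/epi0P: p1E; apply; rewrite -composeA -pu1 composeA tp comp0m.
  have t2 : t ∘ i2 = 0.
    by move/epi0P: p2E; apply; rewrite -composeA -pu2 composeA tp comp0m.
  by rewrite -[t]composem1 -iE composeDr !composeA t1 t2 !comp0m addr0.
apply/kernelP; split.
- apply/mono0P => T t kt.
  have t1 : y1 ∘ t = 0.
    by move/mono0P: k1M; apply; rewrite composeA -v1k -composeA kt compm0.
  have t2 : y2 ∘ t = 0.
    by move/mono0P: k2M; apply; rewrite composeA -v2k -composeA kt compm0.
  by rewrite -[t]compose1m -xE composeDl -!composeA t1 t2 !compm0 addr0.
- rewrite -[p ∘ k]compose1m -iE composeDl -!composeA (composeA r1) (composeA r2).
  rewrite r1p r2p -!composeA v1k v2k (composeA p1) (composeA p2) pk1 pk2.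
  by rewrite !comp0m !compm0 addr0.
move=> T t pt.
have [|z1 kz1] := short_exact_lift (x := v1 ∘ t) kp1.
  by rewrite composeA -r1p -composeA pt compm0.
have [|z2 kz2] := short_exact_lift (x := v2 ∘ t) kp2.
  by rewrite composeA -r2p -composeA pt compm0.
have y1z : y1 ∘ (x1 ∘ z1 + x2 ∘ z2) = z1.
  by rewrite composeDr !composeA y11 y12 comp0m addr0 compose1m.
have y2z : y2 ∘ (x1 ∘ z1 + x2 ∘ z2) = z2.
  by rewrite composeDr !composeA y21 y22 comp0m add0r compose1m.
exists (x1 ∘ z1 + x2 ∘ z2).
rewrite composeDl -!composeA y1z y2z kz1 kz2 !composeA -composeDl uE.
by rewrite compose1m.
Qed.

(** The sum of covers of [A1] and [A2] covers [B] with kernel the sum of the syzygies. Since any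
    cover of [B] may be used, the induction passes to that kernel. *)
Lemma resdim_le_summand n A1 A2 B (i1 : hom A1 B) (i2 : hom A2 B)
    (p1 : hom B A1) (p2 : hom B A2) :
  is_biproduct i1 i2 p1 p2 -> resdim_le X n B -> resdim_le X n A1.
Proof.
elim: n A1 A2 B i1 i2 p1 p2 => [|n IH] A1 A2 B i1 i2 p1 p2 bP.
  exact: resolving_summand bP.
move=> Bn; have [K1 [P1 [k1 [q1 [kq1 XP1]]]]] := coverX A1.
have [K2 [P2 [k2 [q2 [kq2 XP2]]]]] := coverX A2.
have [K [x1 [x2 [y1 [y2 KP]]]]] := abelian_biproduct (abelianP C) K1 K2.
have [P [u1 [u2 [v1 [v2 PP]]]]] := abelian_biproduct (abelianP C) P1 P2.
have XP : X P := resolving_extension resX (short_exact_biproduct PP) XP1 XP2.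
exists K1, P1, k1, q1; split=> //; apply: (IH _ _ _ _ _ _ _ KP).
exact: resdim_le_syzygy (short_exact_sum bP KP PP kq1 kq2) XP Bn.
Qed.

Lemma resdim_fin_thick : thick resdim_fin.
Proof.
split; last 3 first.
- exact: resdim_fin_extension.
- exact: resdim_fin_kernel.
- exact: resdim_fin_cokernel.
by move=> A1 A2 B i1 i2 p1 p2 bP [n Bn]; exists n; apply: resdim_le_summand bP Bn.
Qed.

End ResolutionDimension.


(** * Comparison of dimensions, and compatible hereditary pairs *)

Section Resdim.
Variable C : abelian_category.
Implicit Types (A B : C) (X Y : set C).

(** One direction splices short exact sequences; the other cuts a resolution at the kernel of its
    augmentation, which the shifted resolution resolves. *)
Lemma resolution_resdim_le X n A : resolving X ->
  (exists P : resolution n A, forall i, (i <= n)%N -> X (res_ob P i)) <->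
  resdim_le X n A.
Proof.
move=> resX; split=> [|].
  elim: n A => [|n IH] A [P PX] /=.
    have P1 : is_zero (res_ob P 1) by apply: res_zero.
    have dM : mono (res_d P 0).
      by move=> T u v _; rewrite (is_zeroP' u P1) (is_zeroP' v P1).
    have da : short_exact (res_d P 0) (res_aug P).
      by split; [|exact: res_exact0|exact: res_epi].
    have [|u ua] := short_exact_desc (x := idmor _) da.
      by rewrite compose1m; apply: is_zeroP.
    have au : res_aug P ∘ u = idmor A.
      by apply: (@res_epi _ _ _ P); rewrite -composeA ua composem1 compose1m.
    (* Here the augmentation is invertible. Closure of [X] under isomorphism comes from summands:
       [A] is a summand of the degree-zero term with the zero term of degree one as complement. *)
    apply: (@resolving_summand _ _ resX _ _ _ u (res_d P 0) (res_aug P) 0) (PX 0%N isT).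
    split=> //; rewrite ?comp0m ?compm0 ?addr0 ?(short_exact0 da) //.
    exact/esym/is_zeroP.
  have [K [k ka]] := abelian_kernel (abelianP C) (res_aug P).
  have [kM ak _] := (kernelP _ _).1 ka.
  have [/[dup] ad + dL] := (exactP _ _).1 (res_exact0 P).
  case/(kernelP _ _).1: (ka) => _ _ kL /kL[a kaE].
  have aE : epi a.
    have [T [e [y [eE dy]]]] := dL _ _ ak.
    have ay : a ∘ y = e by apply: kM; rewrite composeA kaE.
    by apply: (@epi_compl _ _ _ _ _ y); rewrite ay.
  have ea : exact (res_d P 1) a.
    have /exactP[d0 d1L] := res_exact P 0.
    apply/exactP; split; first by apply: kM; rewrite composeA kaE d0 compm0.
    by move=> T x ax; apply: d1L; rewrite -kaE -composeA ax compm0.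
  exists K, (res_ob P 0), k, (res_aug P); split; last 1 first.
  - apply: IH.
    exists (@Resolution _ n K (fun i => res_ob P i.+1) (fun i => res_d P i.+1) a
      aE ea (fun i => res_exact P i.+1)
      (fun i ni => @res_zero _ _ _ P i.+1 ni)) => i ni; exact: PX.
  - by apply/short_exact_kernel; split=> //; apply: res_epi.
  - exact: PX.
have [Z Z0] := zero_ex C.
elim: n A => [|n IH] A /= => [XA|[K [P [k [p [kp XP /IH[r rX]]]]]]].
  by exists (trivial_resolution Z0 A); case.
by exists (splice_resolution kp r); case=> // i; apply: rX.
Qed.

Lemma least_some (P : nat -> Prop) n : least P = Some n -> P n.
Proof.
rewrite /least; case: pselect => // h [<-].
by case: ex_minnP => m /asboolP.
Qed.

Lemma dim_finite_least (P : nat -> Prop) :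
  dim_finite (least P) <-> exists n, P n.
Proof.
split=> [[n /least_some Pn]|[n Pn]]; first by exists n.
rewrite /dim_finite /least; case: pselect => [h|[]]; last by exists n; apply/asboolP.
by exists (ex_minn h).
Qed.

Lemma coresolution_op n A (P : C -> Prop) :
  (exists I : coresolution n A, forall i, (i <= n)%N -> P (cores_ob I i)) <->
  (exists I : @resolution (op C) n A, forall i, (i <= n)%N -> P (res_ob I i)).
Proof.
split=> [[I IP]|[I IP]].
  by exists (@Resolution (op C) n A (cores_ob I) (fun i => cores_d I i)
    (cores_aug I) (@cores_mono _ _ _ I) (exact_op (cores_exact0 I))
    (fun i => exact_op (cores_exact I i))
    (fun i ni T => conj (@cores_zero _ _ _ I i ni T).2
                        (@cores_zero _ _ _ I i ni T).1)).
by exists (@Coresolution C n A (res_ob I) (fun i => res_d I i)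
    (res_aug I) (@res_epi _ _ _ I) (exact_op (res_exact0 I))
    (fun i => exact_op (res_exact I i))
    (fun i ni T => conj (@res_zero _ _ _ I i ni T).2
                        (@res_zero _ _ _ I i ni T).1)).
Qed.

Lemma coresdim_op X A : coresdim X A = @resdim (op C) X A.
Proof.
by congr least; apply/funext => n; apply/propext; apply: coresolution_op.
Qed.

Lemma dim_finite_resdim X A : resolving X ->
  dim_finite (resdim X A) <-> resdim_fin X A.
Proof.
move=> resX; rewrite dim_finite_least; split=> [][n].
  by move/resolution_resdim_le => An; exists n; apply: An.
by move=> An; exists n; apply/resolution_resdim_le.
Qed.

Variables Q Rt Qt R : set C.
Hypotheses (hQ : hereditary_pair Q Rt) (hR : hereditary_pair Qt R).
Hypotheses (QtQ : Qt `<=` Q) (RtR : Rt `<=` R) (core : Q `&` Rt = Qt `&` R).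

Let coreE A : Q A -> Rt A -> Qt A /\ R A.
Proof. by move=> QA RtA; have : (Q `&` Rt) A by []; rewrite core. Qed.

Let coreE' A : Qt A -> R A -> Q A /\ Rt A.
Proof. by move=> QtA RA; have : (Qt `&` R) A by []; rewrite -core. Qed.

Let coverQ A : exists (K P : C) (k : hom K P) (p : hom P A),
  short_exact k p /\ Q P.
Proof. by have [K [P [k [p []]]]] := pair_cover hQ A; exists K, P, k, p. Qed.

Let coverQt A : exists (K P : C) (k : hom K P) (p : hom P A),
  short_exact k p /\ Qt P.
Proof. by have [K [P [k [p []]]]] := pair_cover hR A; exists K, P, k, p. Qed.

Lemma left_resdim_fin A : Q A -> resdim_fin Qt A -> Qt A.
Proof.
move=> QA [n]; elim: n A QA => // n IH A QA /= [K [P [k [p [kp QtP Kn]]]]].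
have resQ := pair_left hQ; have resQt := pair_left hR.
have QtK : Qt K.
  by apply: IH Kn; apply: resolving_kernel kp (QtQ QtP) QA.
have [I [L [i [q [iq RI QtL]]]]] := pair_hull hR K.
(* The pushout of K -> P along K -> I. *)
have [E [i' [p' [q' [j [ji pq']]]]]] := @short_exact_pullback2 (op C) _ _ _ _ _
  _ _ _ _ (short_exact_op kp) (short_exact_op iq).
move/op_short_exact: ji => ji; move/op_short_exact: pq' => pq'.
have QtI : Qt I by apply: resolving_extension iq QtK QtL.
have QtE : Qt E by apply: resolving_extension pq' QtP QtL.
have [_ RtI] := coreE' QtI RI.
have [s sE] := pair_split hQ QA RtI ji.
have [r bP] := section_biproduct ji sE.
exact: resolving_summand (biproduct_sym bP) QtE.
Qed.

Lemma right_resdim_fin A : R A -> resdim_fin Qt A -> Rt A.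
Proof.
move=> RA [n]; have resQt := pair_left hR.
elim: n A RA => [|n IH] A RA An; first by case: (coreE' An RA).
have [K [P [k [p [kp QtP RK]]]]] := pair_cover hR A.
have RP : R P.
  exact: (resolving_extension (pair_right hR) (short_exact_op kp) RA RK).
have [_ RtP] := coreE' QtP RP.
have RtK := IH _ RK (resdim_le_syzygy resQt coverQt kp QtP An).
(* In the opposite category this is closure of [Rt] under cokernels of monomorphisms. *)
exact: (resolving_kernel (pair_right hQ) (short_exact_op kp) RtP RtK).
Qed.

Lemma resdim_le_right n A : Rt A -> resdim_le Q n A -> resdim_le Qt n A.
Proof.
elim: n A => [|n IH] A RtA; first by move=> QA; case: (coreE QA RtA).
move=> An; have [K [P [k [p [kp QP RtK]]]]] := pair_cover hQ A.
have RtP : Rt P.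
  exact: (resolving_extension (pair_right hQ) (short_exact_op kp) RtA RtK).
have [QtP _] := coreE QP RtP.
exists K, P, k, p; split=> //; apply: IH => //.
exact: (resdim_le_syzygy (pair_left hQ) coverQ kp QP An).
Qed.

(** The two equalities identify the cotorsion pairs of a Hovey triple with the given ones; in this
    form the result can be dualized. *)
Lemma hovey_core : sup_finite (resdim Q) ->
  let W := [set A | dim_finite (resdim Qt A)] in
  [/\ thick W, W `&` R = Rt & Q `&` W = Qt].
Proof.
have resQ := pair_left hQ; have resQt := pair_left hR.
move=> [N Nsup] W; have WE : W = resdim_fin Qt.
  by apply/funext => A; apply/propext; apply: dim_finite_resdim.
rewrite WE; split; first exact: resdim_fin_thick.
- apply/seteqP; split=> A; first by case=> WA RA; apply: right_resdim_fin.
  move=> RtA; split; last exact: RtR.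
  have [n /least_some An _] := Nsup A.
  exists n; apply: resdim_le_right => //.
  exact/resolution_resdim_le.
- apply/seteqP; split=> A; first by case; apply: left_resdim_fin.
  by move=> QtA; split; [exact: QtQ | exists 0%N].
Qed.

End Resdim.

Theorem theoremD (C : abelian_category) (Q Rt Qt R : set C)
    (hQ : complete_hereditary_cotorsion_pair Q Rt)
    (hR : complete_hereditary_cotorsion_pair Qt R)
    (ha : Qt `<=` Q)
    (hb : Q `&` Rt = Qt `&` R) :
  (sup_finite (resdim Q) ->
     hovey_triple Q [set A | dim_finite (resdim Qt A)] R) /\
  (sup_finite (coresdim R) ->
     hovey_triple Q [set A | dim_finite (coresdim Rt A)] R).
Proof.
have pQ := complete_hereditary_pair hQ; have pR := complete_hereditary_pair hR.
(* Extensions of objects of [Qt] by objects of [Rt] split because [Qt] lies in [Q]. *)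
have RtR : Rt `<=` R.
  move=> B RtB; apply/(cotorsion_pair_rightE _ hR.1.1) => A /ha QA.
  by apply: (pair_split pQ).
split=> [supQ|supR].
  have [tW WR QW] := hovey_core pQ pR ha RtR hb supQ.
  by split; rewrite ?WR ?QW //; [case: hQ|case: hR].
have supR' : @sup_finite (op C) (@resdim (op C) R).
  by case: supR => N NR; exists N => A; rewrite -coresdim_op; apply: NR.
(* In the opposite category the pairs are [(R, Qt)] and [(Rt, Q)]: [R] takes the place of [Q], and
   [Rt] that of [Qt]. *)
have [] := hovey_core (hereditary_pair_op pR) (hereditary_pair_op pQ) RtR ha _ supR'.
  by rewrite setIC -hb setIC.
have -> : [set A | dim_finite (@resdim (op C) Rt A)] =
    [set A | dim_finite (coresdim Rt A)].
  by apply/funext => A /=; rewrite coresdim_op.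
(* Returning from the opposite category exchanges the kernel and cokernel clauses of thickness. *)
move=> [ts te tk tc] WQ RW; split.
- split.
  + by move=> A1 A2 B i1 i2 p1 p2 /biproduct_op; apply: ts.
  + by move=> A B D f g /short_exact_op fg WA WD; apply: te fg _ _.
  + by move=> A B D f g /short_exact_op fg WB WD; apply: tc fg _ _.
  + by move=> A B D f g /short_exact_op fg WA WB; apply: tk fg _ _.
- by rewrite setIC RW; case: hQ.
- by rewrite setIC WQ; case: hR.
Qed.
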